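(* Let $r$ be a positive integer and let $\mathcal{F}$ be the $f$-triangle (of infinite size) for the $r$-colored barycentric subdivision. Then, for all $n\in\mathbb{N}$ and $k,j\in\{0,1,\dots,n\}$, $p_{\mathcal{F}}(n,k,j)$ is equal to the number of $r$-colored permutations $w \in \mathbb{Z}_r \wr \mathfrak{S}_{n+1}$ which have first coordinate of zero color, $j$ descents and last coordinate of zero color and equal to $n+1-k$.
   Context: Conventions: $\mathbb{N} = \{0,1,2,\dots\}$; $\binom{a}{b}:=0$ unless $0\le b\le a$. Simplicial complexes are finite abstract simplicial complexes (containing the empty face, of dimension $-1$). $\sigma_n$ is the $(n-1)$-dimensional simplex (the complex of all its faces). Barycentric subdivision: $\mathrm{sd}(\Delta)$ is the simplicial complex of all chains in the poset of nonempty faces of $\Delta$. Edgewise subdivision: given a linear ordering $v_1,\dots,v_m$ of the vertex set $V(\Delta)$, let $V_r(\Delta)$ be the set of maps $f:V(\Delta)\to\mathbb{N}$ with $\mathrm{supp}(f)=\{v: f(v)\ne0\}\in\Delta$ and $f(v_1)+\cdots+f(v_m)=r$, and let $\iota(f)(v_j)=f(v_1)+\cdots+f(v_j)$. The $r$-fold edgewise subdivision $\mathrm{esd}_r(\Delta)$ is the simplicial complex on vertex set $V_r(\Delta)$ whose faces are the sets $E\subseteq V_r(\Delta)$ with $\bigcup_{f\in E}\mathrm{supp}(f)\in\Delta$ and, for all $f,g\in E$, $\iota(f)-\iota(g)\in\{0,1\}^{V(\Delta)}$ or $\iota(g)-\iota(f)\in\{0,1\}^{V(\Delta)}$ (its face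 numbers do not depend on the ordering). The $r$-colored barycentric subdivision of $\Delta$ is $\mathrm{esd}_r(\mathrm{sd}(\Delta))$. Its $f$-triangle is $\mathcal{F}=(f_{\mathcal{F}}(i,j))_{0\le i\le j<\infty}$, where $f_{\mathcal{F}}(i,j)$ is the number of $(i-1)$-dimensional faces of the $r$-colored barycentric subdivision of $\sigma_j$. Put $f_{\mathcal{F}}(\sigma_n,x) = \sum_{i=0}^n f_{\mathcal{F}}(i,n)x^i$, $h_{\mathcal{F}}(\sigma_n,x) = (1-x)^n f_{\mathcal{F}}(\sigma_n,\frac{x}{1-x})$, $\ell_{\mathcal{F}}(\sigma_n,x) = \sum_{k=0}^n (-1)^{n-k}\binom{n}{k} h_{\mathcal{F}}(\sigma_k,x)$, and for $0\le k\le n$ $$p_{\mathcal{F},n,k}(x) = \sum_{s=0}^n \ell_{\mathcal{F}}(\sigma_s,x) \sum_{i=0}^s \binom{n-k}{i}\binom{k}{s-i} x^{k-s+i} =: \sum_{j=0}^n p_{\mathcal{F}}(n,k,j)x^j.$$ (The $h$-polynomial of the $r$-colored barycentric subdivision of any $(n-1)$-dimensional simplicial complex $\Delta$ with $h$-vector $(h_k(\Delta))$ equals $\sum_{k=0}^n h_k(\Delta)p_{\mathcal{F},n,k}(x)$.) An $r$-colored permutation $w\in\mathbb{Z}_r\wr\mathfrak{S}_N$ is a pair $(\tau,\varepsilon)$, where $\tau=(\tau(1),\dots,\tau(N))$ is a permutation of $\{1,\dots,N\}$ and $\varepsilon=(\varepsilon_1,\dots,\varepsilon_N)\in\{0,1,\dots,r-1\}^N$;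 $\tau(i)$ is the $i$th coordinate and $\varepsilon_i$ its color. An index $1\le i\le N$ is a descent of $w$ if either $\varepsilon_i>\varepsilon_{i+1}$, or $\varepsilon_i=\varepsilon_{i+1}$ and $\tau(i)>\tau(i+1)$, where $\tau(N+1):=N+1$ and $\varepsilon_{N+1}:=0$. (Here $N=n+1$.) *)

(* Defs.v *)
From HB Require Import structures.
From mathcomp Require Import all_boot all_order all_fingroup all_algebra.

Set Implicit Arguments.
Unset Strict Implicit.
Unset Printing Implicit Defensive.

Import GRing.Theory.
Local Open Scope ring_scope.

Record simplicial_complex (T : finType) := SimplicialComplex {
  faces :> {set {set T}};
  faces0 : set0 \in faces;
  faces_sub : forall A B : {set T}, A \subset B -> B \in faces -> A \in faces
}.

Section Complexes.

Variables (T : finType) (D : simplicial_complex T).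

Definition vertices : {set T} := [set v | [set v] \in faces D].

(* An (i-1)-dimensional face has i vertices. *)
Definition face_number (i : nat) : nat := #|[set A in faces D | #|A| == i]|.

(* [s] lists the vertices v_1, ..., v_m, each exactly once. *)
Definition vertex_ordering (s : seq T) : bool := perm_eq s (enum vertices).

End Complexes.

Fact simplex_faces0 n : set0 \in [set: {set 'I_n}].
Proof. by rewrite inE. Qed.

Fact simplex_faces_sub n (A B : {set 'I_n}) :
  A \subset B -> B \in [set: {set 'I_n}] -> A \in [set: {set 'I_n}].
Proof. by rewrite !inE. Qed.

Definition simplex (n : nat) : simplicial_complex 'I_n :=
  SimplicialComplex (simplex_faces0 n) (@simplex_faces_sub n).

Section BarycentricSubdivision.

Variables (T : finType) (D : simplicial_complex T).

Definition sd_faces : {set {set {set T}}} :=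
  [set C : {set {set T}} |
    [forall A in C, (A \in faces D) && (A != set0)] &&
    [forall A in C, forall B in C, (A \subset B) || (B \subset A)]].

Fact sd_faces0 : set0 \in sd_faces.
Proof.
by rewrite inE; apply/andP; split; apply/forall_inP => A; rewrite inE.
Qed.

Fact sd_faces_sub (C C' : {set {set T}}) :
  C \subset C' -> C' \in sd_faces -> C \in sd_faces.
Proof.
move=> /subsetP sCC'; rewrite !inE => /andP[/forall_inP DC' /forall_inP chC'].
apply/andP; split; first by apply/forall_inP => A /sCC'; apply: DC'.
apply/forall_inP => A /sCC' AC'; apply/forall_inP => B /sCC' BC'.
by move/forall_inP: (chC' A AC'); apply.
Qed.

Definition sd : simplicial_complex {set T} :=
  SimplicialComplex sd_faces0 sd_faces_sub.

End BarycentricSubdivision.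

Section EdgewiseSubdivision.

Variables (T : finType) (r : nat) (D : simplicial_complex T) (s : seq T).

(* A map f : V(D) -> nat with sum r only takes values at most r; it is extended
   by 0 to the elements of [T] that are not vertices of [D], which is enforced
   by [fsupp f \in faces D]. *)
Notation vmap := {ffun T -> 'I_r.+1}.

Definition fsupp (f : vmap) : {set T} := [set v | (f v : nat) != 0%N].

Definition esd_vertices : {set vmap} :=
  [set f : vmap | (fsupp f \in faces D) &&
                  ((\sum_(v in vertices D) (f v : nat))%N == r)].

(* f(v_1) + ... + f(v_j) when v = v_j is the j-th element of [s] *)
Definition iota_map (f : vmap) (v : T) : nat :=
  (\sum_(u <- take (index v s).+1 s) (f u : nat))%N.

(* iota(f) - iota(g) belongs to {0,1}^V(D) *)
Definition iota_diff01 (f g : vmap) : bool :=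
  [forall v in vertices D,
     (iota_map f v == iota_map g v) || (iota_map f v == (iota_map g v).+1)].

Definition esd_faces : {set {set vmap}} :=
  [set E : {set vmap} |
    [&& E \subset esd_vertices,
        (\bigcup_(f in E) fsupp f)%SET \in faces D &
        [forall f in E, forall g in E, iota_diff01 f g || iota_diff01 g f]]].

Fact esd_faces0 : set0 \in esd_faces.
Proof.
rewrite inE sub0set big_set0 faces0 /=.
by apply/forall_inP => f; rewrite inE.
Qed.

Fact esd_faces_sub (E E' : {set vmap}) :
  E \subset E' -> E' \in esd_faces -> E \in esd_faces.
Proof.
move=> sEE'; rewrite !inE => /and3P[VE' DE' /forall_inP iE'].
have /subsetP sub := sEE'; apply/and3P; split.
- exact: subset_trans VE'.
- apply: faces_sub DE'; apply/bigcupsP => f /sub fE'.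
  exact: (bigcup_sup f).
- apply/forall_inP => f /sub fE'; apply/forall_inP => g /sub gE'.
  by move/forall_inP: (iE' f fE'); apply.
Qed.

Definition esd : simplicial_complex vmap :=
  SimplicialComplex esd_faces0 esd_faces_sub.

End EdgewiseSubdivision.

(* The [f]-triangle of the r-colored barycentric subdivision, where [ord j] is
   the ordering of the vertices of sd(sigma_j) used to form esd_r. *)
Definition colored_sd_triangle (r : nat) (ord : forall j, seq {set 'I_j})
    (i j : nat) : nat :=
  face_number (esd r (sd (simplex j)) (ord j)) i.

Section TrianglePolynomials.

Variable F : nat -> nat -> nat.

Definition f_poly (n : nat) : {poly int} := \sum_(i < n.+1) (F i n)%:R *: 'X^i.

(* (1-x)^n f(x/(1-x)) with denominators cleared: [h_polyE] is the identity of
   rational functions, evaluated at any x != 1 in any field *)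
Definition h_poly (n : nat) : {poly int} :=
  \sum_(i < n.+1) (F i n)%:R *: ('X^i * (1 - 'X) ^+ (n - i)).

Lemma h_polyE (n : nat) (K : fieldType) (x : K) : x != 1 ->
  (map_poly intr (h_poly n)).[x] =
  (1 - x) ^+ n * (map_poly intr (f_poly n)).[x / (1 - x)].
Proof.
move=> x1; have y0 : 1 - x != 0 by rewrite subr_eq0 eq_sym.
rewrite /h_poly /f_poly !rmorph_sum !horner_sum mulr_sumr.
apply: eq_bigr => i _ /=; have le_in : (i <= n)%N by rewrite -ltnS.
rewrite !map_polyZ rmorphM !rmorphXn rmorphB rmorph1 /= map_polyX !hornerZ.
rewrite hornerM !horner_exp !hornerE.
rewrite -[RHS]mulrA [RHS]mulrCA -?[LHS]mulrA; congr (_ * _).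
rewrite exprMn exprVn [RHS]mulrCA; congr (_ * _).
move: (nat_of_ord i) le_in => m le_mn.
by rewrite -[in RHS](subnK le_mn) exprD mulfK // expf_neq0.
Qed.

Definition l_poly (n : nat) : {poly int} :=
  \sum_(k < n.+1) (-1) ^+ (n - k) *: ('C(n, k)%:R *: h_poly k).

(* The truncated exponent [k + i - s] is k-s+i: if k-s+i is negative then
   k < s-i and the factor 'C(k, s - i) vanishes. *)
Definition p_poly (n k : nat) : {poly int} :=
  \sum_(s < n.+1) l_poly s *
    \sum_(i < s.+1) ('C(n - k, i) * 'C(k, s - i))%:R *: 'X^(k + i - s).

Definition p_coef (n k j : nat) : int := (p_poly n k)`_j.

End TrianglePolynomials.

Definition colored_perm (r N : nat) : finType :=
  ('S_N * {ffun 'I_N -> 'I_r})%type.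

Section ColoredPermutations.

Variables (r N : nat) (w : colored_perm r N).

(* Positions are numbered from 0 to N-1, and position N carries the conventional
   value N+1 and color 0; the coordinates take values in {1, ..., N}. *)
Definition coordinate (i : nat) : nat :=
  if insub i is Some j then (w.1 j : nat).+1 else N.+1.

Definition color (i : nat) : nat :=
  if insub i is Some j then w.2 j : nat else 0%N.

Definition is_descent (i : nat) : bool :=
  (color i.+1 < color i)%N ||
  ((color i == color i.+1) && (coordinate i.+1 < coordinate i)%N).

Definition descents : nat := #|[set i : 'I_N | is_descent i]|.

End ColoredPermutations.

(* Main.v *)
Require Import Defs.
From HB Require Import structures.
From mathcomp Require Import all_boot all_order all_fingroup all_algebra.
From mathcomp Require Import zify ring.

(** Both sides are determined by power series of the form
      sum_m a(m) t^m = P(t) / (1 - t)^n,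
    where P is recovered from the sequence a as its n-th backward difference;
    [numerator n P a] expresses this relation.

    Complexes.  The elements of [esd_vertices m D] are the monomials of degree m
    whose support is a face of D.  A face with i vertices supports as many of
    them as there are compositions of m into i positive parts, so the
    h-polynomial of a complex of dimension n - 1 is the numerator, for the
    exponent n, of the sequence counting its monomials
    ([card_esd_vertices], [eq_face_polynomial]).  A monomial of degree r m on D
    is the product, in exactly one way, of m vertices of a common face of
    esd_r(D): its partial sums G(v) have to be shared as evenly as possible,
    and the i-th vertex receives the partial sums floor((G(v) + i) / m)
    ([card_esd_vertices_esd]).  A monomial of degree m on the barycentric
    subdivision of a simplex is a multichain of m nonempty subsets of [n],
    that is, a map from [n] to {0, ..., m} taking the value m
    ([card_esd_vertices_sd_simplex]).  Altogether the h-polynomial of the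
    r-colored subdivision of the simplex with n > 0 vertices is the numerator
    of (r m + 1)^n - (r m)^n.

    Colored permutations.  Let B_n(c, v) be the descent generating polynomial
    of the colored permutations of n + 1 letters whose first color is 0 and
    whose last letter has color c and v smaller values.  Removing the last
    letter shows how B_(n+1) varies with it: passing from v to v + 1 adds
    (1 - t) B_n(c, v), passing from the largest value of color c to the smallest
    one of color c + 1 changes nothing, and the smallest letter of all gives t
    times the polynomial of the largest one.  These relations have only one
    solution, and it is the numerator of an explicit sequence
    ([numerator_last_letter_gf]).  For c = 0 and v = n > 0
    the sequence is the one found for the simplex, so the h-polynomial equals
    B_n(0, n).

    Conclusion.  Read umbrally, with w^i standing for the h-polynomial of the
    simplex with i vertices, the local h-polynomials are the powers of w - 1 and
    p_(n,k) is w^(n-k) (w - (1 - t))^k ([p_poly_umbral]).  Hence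
    p_(n+1,k+1) = p_(n+1,k) - (1 - t) p_(n,k), which is the rule governing
    B_n(0, n - k); the two agree for k = 0, hence for all k. *)

Set Implicit Arguments.
Unset Strict Implicit.
Unset Printing Implicit Defensive.

Import GRing.Theory Num.Theory.

(** * Numerators of rational generating functions *)

Section Numerators.
Local Open Scope ring_scope.

Definition delay (a : nat -> int) (m : nat) : int :=
  if m is m'.+1 then a m' else 0.

Definition backdiff (a : nat -> int) (m : nat) : int := a m - delay a m.

(** The formal power series with coefficients [a] is [P] divided by the [n]-th
    power of 1 - t. *)
Definition numerator (n : nat) (P : {poly int}) (a : nat -> int) : Prop :=
  forall m, P`_m = iter n backdiff a m.

Lemma eq_iter_backdiff n a b :
  a =1 b -> iter n backdiff a =1 iter n backdiff b.
Proof.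
move=> ab; elim: n => //= n IHn m.
by rewrite /backdiff IHn; case: m => //= m; rewrite IHn.
Qed.

Lemma iter_backdiff_delay n a :
  iter n backdiff (delay a) =1 delay (iter n backdiff a).
Proof.
elim: n => //= n IHn m; rewrite /backdiff IHn.
by case: m => [|m] /=; rewrite ?subr0 // IHn.
Qed.

Lemma iter_backdiffD n a b m :
  iter n backdiff (fun i => a i + b i) m =
  iter n backdiff a m + iter n backdiff b m.
Proof.
elim: n m => //= n IHn m; rewrite /backdiff IHn.
by case: m => [|m] /=; rewrite ?IHn; ring.
Qed.

Lemma iter_backdiffZ n c a m :
  iter n backdiff (fun i => c * a i) m = c * iter n backdiff a m.
Proof.
elim: n m => //= n IHn m; rewrite /backdiff IHn.
by case: m => [|m] /=; rewrite ?IHn; ring.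
Qed.

Lemma eq_numerator n P a b : a =1 b -> numerator n P a -> numerator n P b.
Proof. by move=> ab Pa m; rewrite Pa; apply: eq_iter_backdiff. Qed.

Lemma numerator_inj n P Q a : numerator n P a -> numerator n Q a -> P = Q.
Proof. by move=> Pa Qa; apply/polyP=> m; rewrite Pa Qa. Qed.

Lemma numeratorD n P Q a b :
  numerator n P a -> numerator n Q b ->
  numerator n (P + Q) (fun m => a m + b m).
Proof. by move=> Pa Qb m; rewrite coefD Pa Qb iter_backdiffD. Qed.

Lemma numeratorZ n c P a :
  numerator n P a -> numerator n (c *: P) (fun m => c * a m).
Proof. by move=> Pa m; rewrite coefZ Pa iter_backdiffZ. Qed.

Lemma numerator0 n : numerator n 0 (fun=> 0).
Proof.
have eq0 : (fun=> 0) =1 (fun m : nat => 0 * 0 : int) by move=> m; rewrite mul0r.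
by move=> m; rewrite coef0 (eq_iter_backdiff n eq0) iter_backdiffZ mul0r.
Qed.

Lemma numerator_sum n K (F : nat -> {poly int}) (a : nat -> nat -> int) :
  (forall i, (i < K)%N -> numerator n (F i) (a i)) ->
  numerator n (\sum_(i < K) F i) (fun m => \sum_(i < K) a i m).
Proof.
elim: K => [|K IHK] Fa.
  rewrite big_ord0; apply: eq_numerator (numerator0 n) => m.
  by rewrite big_ord0.
rewrite big_ord_recr; apply: eq_numerator (numeratorD (IHK _) (Fa K _)) => //.
  by move=> m; rewrite big_ord_recr.
by move=> i iK; apply/Fa/ltnW.
Qed.

Lemma numeratorX n P a : numerator n P a -> numerator n ('X * P) (delay a).
Proof.
move=> Pa m; rewrite iter_backdiff_delay coefXM.
by case: m => //= m; rewrite Pa.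
Qed.

(** The same series with one more factor 1 - t above and below. *)
Lemma numeratorS n P a : numerator n P a -> numerator n.+1 ((1 - 'X) * P) a.
Proof.
move=> Pa m; rewrite mulrBl mul1r coefB (numeratorX Pa) Pa /=.
by rewrite iter_backdiff_delay.
Qed.

Lemma numerator_iter n d P a :
  numerator n P a -> numerator (n + d) ((1 - 'X) ^+ d * P) a.
Proof.
move=> Pa; elim: d => [|d IHd]; first by rewrite addn0 expr0 mul1r.
by rewrite addnS exprS -mulrA; apply: numeratorS.
Qed.

(** The number of ways to write [m] as an ordered sum of [i] positive parts:
    removing the last part leaves a sum of [i.-1] parts equal to some
    [l < m]. *)
Fixpoint compositions (i m : nat) : nat :=
  if i is i'.+1 then (\sum_(l < m) compositions i' l)%N else (m == 0)%N.

(** A sum of [i] positive parts is an [i]-fold product of geometric series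
    t / (1 - t). *)
Lemma numerator_compositions n i :
  (i <= n)%N ->
  numerator n ('X^i * (1 - 'X) ^+ (n - i)) (fun m => (compositions i m)%:R).
Proof.
elim: i n => [|i IHi] n le_in.
  rewrite expr0 mul1r subn0 -[n in numerator n]add0n -[_ ^+ n]mulr1.
  by apply: numerator_iter => m /=; rewrite coef1; case: m.
case: n le_in => // n le_in; rewrite subSS exprS -mulrA => m.
rewrite (numeratorX (IHi n le_in)) iterSr; apply: eq_iter_backdiff => {}m.
rewrite /backdiff; case: m => [|m] /=; first by rewrite big_ord0 subr0.
by rewrite big_ord_recr /= natrD addrAC subrr add0r.
Qed.

(** With the exponent [K] the h-polynomial formed from [F] is the numerator of
    [a], that is, B (1 - t)^(K - n).  As long as the exponent exceeds [n],
    evaluation at t = 1 isolates the top face number and shows that it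
    vanishes, which lowers the exponent by 1; at [n] only [B] remains. *)
Lemma eq_face_polynomial n K (F : nat -> nat) B a : (n <= K)%N ->
  (forall m, \sum_(i < K.+1) (F i * compositions i m)%:R = a m) ->
  numerator n B a ->
  \sum_(i < n.+1) (F i)%:R *: ('X^i * (1 - 'X) ^+ (n - i)) = B :> {poly int}.
Proof.
move=> le_nK Fa Ba.
pose h k : {poly int} :=
  \sum_(i < k.+1) (F i)%:R *: ('X^i * (1 - 'X) ^+ (k - i)).
rewrite -/(h n).
have hK : h K = (1 - 'X) ^+ (K - n) * B.
  apply: (@numerator_inj K _ _ a); last first.
    by rewrite -{1}(subnKC le_nK); apply: numerator_iter.
  apply: (@eq_numerator _ _ (fun m =>
            \sum_(i < K.+1) (F i)%:R * (compositions i m)%:R)) => [m|].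
    by rewrite -Fa; apply: eq_bigr => i _; rewrite natrM.
  apply: (@numerator_sum _ _
    (fun i => (F i)%:R *: ('X^i * (1 - 'X) ^+ (K - i)))
    (fun i m => (F i)%:R * (compositions i m)%:R)) => i le_iK.
  exact/numeratorZ/numerator_compositions.
(* A dimension at a time, cancel one factor 1 - 'X on both sides. *)
suff down d : (d <= K - n)%N -> h (n + d)%N = (1 - 'X) ^+ d * B.
  by have := down 0%N (leq0n _); rewrite addn0 expr0 mul1r.
move=> le_d; rewrite -(subKn le_d); set e := (K - n - d)%N.
have : (e <= K - n)%N by rewrite leq_subr.
elim: e => [|e IHe] le_e; first by rewrite subn0 subnKC.
have {IHe} := IHe (ltnW le_e); rewrite -(subnSK le_e) addnS.
set d' := (K - n - e.+1)%N => hS.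
have hrec : h (n + d').+1 =
    (1 - 'X) * h (n + d')%N + (F (n + d').+1)%:R *: 'X^((n + d').+1).
  rewrite /h big_ord_recr /= subnn expr0 mulr1 mulr_sumr; congr (_ + _).
  apply: eq_bigr => i _; rewrite -scalerAr subSn; last by rewrite -ltnS.
  by rewrite exprS mulrCA.
have F0 : (F (n + d').+1)%:R = 0 :> int.
  move: (congr1 (fun P : {poly int} => P.[1]) (etrans (esym hrec) hS)).
  rewrite hornerD hornerZ !hornerM !horner_exp hornerD hornerN hornerX.
  by rewrite hornerC subrr expr0n !mul0r add0r expr1n mulr1.
move: hS; rewrite hrec F0 scale0r addr0 exprS -mulrA.
by apply: mulfI; rewrite -opprB oppr_eq0 -polyC1 polyXsubC_eq0.
Qed.

End Numerators.

(** * Monomials supported on a complex *)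

Section MonomialsOfComplex.
Local Open Scope ring_scope.

Lemma coef_positive_powers M i m : (m <= M)%N ->
  ((\sum_(k < M.+1 | (k : nat) != 0%N) 'X^k : {poly int}) ^+ i)`_m =
  (compositions i m)%:R.
Proof.
elim: i m => [|i IHi] m le_mM; first by rewrite expr0 coef1.
rewrite exprSr coefM /= natr_sum big_ord_recr /=.
have coefS k : (k <= M)%N ->
    (\sum_(l < M.+1 | (l : nat) != 0%N) 'X^l : {poly int})`_k = (k != 0%N)%:R.
  move=> le_kM; rewrite coef_sum big_mkcond (bigD1 (inord k)) //= inordK //.
  rewrite big1 => [|l neq_lk]; rewrite coefXn.
    by rewrite eqxx addr0; case: (k != 0%N).
  case: (eqVneq k l) => [eq_kl|_]; last by case: ifP.
  by case/eqP: neq_lk; rewrite eq_kl inord_val.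
rewrite subnn coefS // mulr0 addr0; apply: eq_bigr => l _.
have lt_lm := ltn_ord l.
rewrite IHi ?coefS; last by rewrite ltnW // (leq_trans lt_lm).
  by rewrite -lt0n subn_gt0 lt_lm mulr1.
by rewrite (leq_trans (leq_subr _ _)).
Qed.

(** Expanding the product over [v] of the geometric series t + t^2 + ... for
    [v \in A] and of 1 for the other [v] enumerates the monomials with support
    [A], graded by their degree. *)
Lemma card_full_support (T : finType) (A : {set T}) m :
  #|[set f : {ffun T -> 'I_m.+1} |
      (fsupp f == A) && ((\sum_v (f v : nat))%N == m)]| =
  compositions #|A| m.
Proof.
pose G (v : T) (k : 'I_m.+1) : {poly int} :=
  if ((k : nat) != 0%N) == (v \in A) then 'X^k else 0.
have GA : \prod_v \sum_k G v k =
    (\sum_(k < m.+1 | (k : nat) != 0%N) 'X^k) ^+ #|A|.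
  rewrite -prodr_const [RHS]big_mkcond; apply: eq_bigr => v _.
  rewrite /G; case: (v \in A).
    by rewrite [RHS]big_mkcond; apply: eq_bigr => k _; rewrite eqb_id.
  rewrite big_ord_recl /= expr0 big1 ?addr0 //.
apply/eqP; rewrite -(eqr_nat int) -(coef_positive_powers _ (leqnn m)) -GA.
rewrite bigA_distr_bigA /= coef_sum -sum1_card natr_sum big_mkcond /=.
apply/eqP; apply: eq_bigr => f _; rewrite inE.
have [supp_f|] := boolP (fsupp f == A).
  rewrite (eq_bigr (fun v => 'X^(f v))) => [|v _].
    by rewrite -expr_sum coefXn eq_sym andTb; case: eqP.
  by rewrite /G -(eqP supp_f) inE eqxx.
move=> supp_f; suff [v fv] : exists v, ((f v : nat) != 0%N) != (v \in A).
  have Gv0 : G v (f v) = 0 by rewrite /G (negbTE fv).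
  by rewrite /= (bigD1 v) //= Gv0 mul0r coef0.
apply/existsP; apply: contraR supp_f; rewrite negb_exists => /forallP fA.
by apply/eqP/setP=> v; rewrite inE; have := fA v; rewrite negbK => /eqP.
Qed.

(** The Hilbert function of a complex: the monomials are sorted by their
    support, and the supports by their cardinal. *)
Lemma card_esd_vertices (T : finType) (D : simplicial_complex T) m K :
  (#|T| <= K)%N ->
  #|esd_vertices m D| =
  (\sum_(i < K.+1) face_number D i * compositions i m)%N.
Proof.
move=> le_TK; pose supp := @fsupp T m.
have supp_faces f : f \in esd_vertices m D -> supp f \in faces D.
  by rewrite inE => /andP[].
have cardK (A : {set T}) : (inord #|A| : 'I_K.+1) = #|A| :> nat.
  by rewrite inordK // ltnS (leq_trans (max_card _)).
rewrite -sum1_card (partition_big supp (mem (faces D))) //=.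
rewrite (partition_big (fun A : {set T} => inord #|A| : 'I_K.+1) predT) //=.
apply: eq_bigr => i _; rewrite /face_number -sum_nat_const.
apply: eq_big => [A|A /andP[DA /eqP <-]].
  by rewrite inE; congr (_ && _); rewrite -val_eqE /= cardK.
rewrite cardK -(card_full_support A m) sum1dep_card.
apply: eq_card => f; rewrite !inE andbC -/(supp f).
have [suppA|//] := eqVneq (supp f) A; rewrite -/(supp f) suppA DA /=.
congr (_ == _); rewrite [RHS](bigID (mem (vertices D))) /=.
rewrite [X in (_ + X)%N]big1 ?addn0 // => v; rewrite inE.
apply: contraNeq => fv.
by apply: faces_sub DA; rewrite sub1set -suppA inE.
Qed.

End MonomialsOfComplex.

(** * Monomials as multisets of vertices *)

Section Multisets.

Definition multiplicity (U : finType) m (t : seq U) : {ffun U -> 'I_m.+1} :=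
  [ffun x => inord (count_mem x t)].

Lemma multiplicityE (U : finType) m (t : seq U) x :
  size t = m -> multiplicity m t x = count_mem x t :> nat.
Proof. by move=> <-; rewrite ffunE inordK // ltnS count_size. Qed.

Lemma sum_multiplicity (U : finType) (t : seq U) (h : U -> nat) :
  (\sum_x count_mem x t * h x = \sum_(x <- t) h x)%N.
Proof.
elim: t => [|y t IHt]; first by rewrite big_nil big1.
rewrite big_cons -IHt /= (eq_bigr _ (fun x _ => mulnDl _ _ _)) big_split /=.
congr addn; rewrite (bigD1 y) //= eqxx mul1n big1 ?addn0 // => x /negbTE neq_xy.
by rewrite eq_sym neq_xy mul0n.
Qed.

Lemma multiset_listing (U : finType) m (phi : {ffun U -> 'I_m.+1}) :
  exists t : seq U, forall x, count_mem x t = phi x.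
Proof.
exists (flatten [seq nseq (phi x) x | x <- enum U]) => x.
rewrite count_flatten -map_comp sumnE big_map big_enum /= (bigD1 x) //=.
rewrite count_nseq /= eqxx mul1n big1 ?addn0 // => y /negbTE neq_yx.
by rewrite count_nseq /= neq_yx.
Qed.

(** The form in which monomials are counted below: a monomial of degree [m] is a
    list of [m] vertices of a face up to order, so it suffices to attach to each
    [y \in X] such a list, in such a way that each class of lists is reached
    exactly once. *)
Lemma card_esd_vertices_decode (U Y : finType) (D : simplicial_complex U) m
    (X : {set Y}) (dec : Y -> seq U) :
  {in X, forall y, size (dec y) = m} ->
  {in X, forall y, [set x in dec y] \in faces D} ->
  {in X &, forall y y', perm_eq (dec y) (dec y') -> y = y'} ->
  (forall t : seq U, size t = m -> [set x in t] \in faces D ->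
     exists2 y, y \in X & perm_eq (dec y) t) ->
  #|esd_vertices m D| = #|X|.
Proof.
move=> size_dec face_dec dec_inj dec_surj.
have fsupp_mult t : size t = m -> fsupp (multiplicity m t) = [set x in t].
  move=> size_t; apply/setP=> x.
  by rewrite !inE multiplicityE // -has_pred1 has_count lt0n.
have mult_dec y : y \in X ->
    multiplicity m (dec y) \in esd_vertices m D.
  move=> Xy; rewrite inE fsupp_mult ?size_dec // face_dec //=.
  rewrite -[X in _ == X](size_dec _ Xy) -sum1_size -sum_multiplicity.
  rewrite big_mkcond; apply/eqP/eq_bigr => x _.
  rewrite multiplicityE ?size_dec // muln1; case: ifP => // /negbT.
  rewrite inE; apply: contraNeq => xy.
  apply: faces_sub (face_dec y Xy); rewrite sub1set inE.
  by rewrite -has_pred1 has_count lt0n eq_sym.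
have mult_inj : {in X &, injective (fun y => multiplicity m (dec y))}.
  move=> y y' Xy Xy' eq_yy'; apply: dec_inj => //; apply/allP=> x _ /=.
  by rewrite -!(multiplicityE _ (size_dec _ _)) // eq_yy'.
rewrite -(card_in_imset mult_inj); apply/eq_card => phi.
apply/idP/imsetP => [|[y Xy ->]]; last exact: mult_dec.
rewrite inE => /andP[Dphi /eqP sum_phi].
have [t tE] := multiset_listing phi.
have size_t : size t = m.
  rewrite -sum_phi -sum1_size -sum_multiplicity [RHS]big_mkcond.
  apply: eq_bigr => x _; rewrite tE muln1; case: ifP => // /negbT.
  rewrite inE; apply: contraNeq => phix; apply: faces_sub Dphi.
  by rewrite sub1set inE.
have phiE : phi = multiplicity m t.
  by apply/ffunP=> x; apply: val_inj; rewrite /= multiplicityE.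
have [|y Xy dec_y] := dec_surj t size_t; first by rewrite -fsupp_mult // -phiE.
exists y => //; rewrite phiE; apply/ffunP=> x; rewrite !ffunE.
by rewrite (seq.permP dec_y).
Qed.

End Multisets.

(** * Multichains of nonempty subsets *)

Section SdSimplex.

Lemma count_ltn_iota k M :
  (k <= M)%N -> count (fun l => (l < k)%N) (iota 0 M) = k.
Proof.
move=> le_kM; rewrite -(subnKC le_kM) iotaD count_cat.
rewrite (eq_in_count (_ : {in _, _ =1 xpredT})) ?count_predT ?size_iota.
  rewrite [X in (_ + X)%N](eq_in_count (_ : {in _, _ =1 pred0})).
    by rewrite count_pred0 addn0.
  by move=> l; rewrite mem_iota add0n => /andP[le_kl _]; rewrite ltnNge le_kl.
by move=> l; rewrite mem_iota.
Qed.

(** In a decreasing list of sets the members containing [i] come first. *)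
Lemma mem_nth_decreasing (T : finType) (t : seq {set T}) l i :
  (forall l l', (l <= l' < size t)%N -> nth set0 t l' \subset nth set0 t l) ->
  (l < size t)%N ->
  (i \in nth set0 t l) = (l < count (fun A : {set T} => i \in A) t)%N.
Proof.
move=> sub_t lt_lt; rewrite -[t in count _ t](cat_take_drop l) count_cat.
have size_take : size (take l t) = l by rewrite size_takel // ltnW.
rewrite (drop_nth set0) //=.
have [i_l|i'l] := boolP (i \in nth set0 t l).
  have /eqP-> : count (fun A : {set T} => i \in A) (take l t) == l.
    rewrite -[X in _ == X]size_take -all_count; apply/allP=> A.
    case/(nthP set0)=> l'; rewrite size_take => lt_l'l <-.
    rewrite nth_take //; apply: subsetP i_l; apply: sub_t.
    by rewrite ltnW.
  by rewrite add1n addnS ltnS leq_addr.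
rewrite add0n; apply/esym/negbTE; rewrite -leqNgt.
have /eqP-> : count (fun A : {set T} => i \in A) (drop l.+1 t) == 0.
  rewrite -leqn0 leqNgt -has_count; apply/hasPn=> A.
  case/(nthP set0)=> l'; rewrite size_drop ltn_subRL => lt_l't <-.
  rewrite nth_drop; apply: contra i'l; apply/subsetP/sub_t.
  by rewrite lt_l't andbT (leq_trans (leqnSn l)) ?leq_addr.
by rewrite addn0 -[X in (_ <= X)%N]size_take count_size.
Qed.

(** A multichain of [M] nonempty subsets of [n+1] is recorded by the function
    that tells in how many of its members each point lies: its members are the
    level sets of that function, and they are nonempty exactly when the smallest
    one is, that is, when the value [M] is taken.  Hence the count is that of
    all functions to {0, ..., M} minus that of the functions to
    {0, ..., M - 1}. *)
Lemma card_esd_vertices_sd_simplex n M :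
  #|esd_vertices M (sd (simplex n.+1))| = (M.+1 ^ n.+1 - M ^ n.+1)%N.
Proof.
pose X := [set u : {ffun 'I_n.+1 -> 'I_M.+1} | [exists i, u i == ord_max]].
pose dec (u : {ffun 'I_n.+1 -> 'I_M.+1}) :=
  [seq [set i | (l < u i)%N] | l <- iota 0 M].
have dec_count (u : {ffun 'I_n.+1 -> 'I_M.+1}) i :
    count (fun A : {set 'I_n.+1} => i \in A) (dec u) = u i.
  rewrite count_map (eq_count (_ : _ =1 fun l => (l < u i)%N)); last first.
    by move=> l; rewrite /= inE.
  by rewrite count_ltn_iota // -ltnS.
rewrite (@card_esd_vertices_decode _ _ _ _ X dec).
- have -> : X = ~: [set u | u \in ffun_on (predC1 (ord_max : 'I_M.+1))].
    apply/setP=> u; rewrite !inE; apply/existsP/idP.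
      by case=> i /eqP ui; apply/ffun_onP=> /(_ i); rewrite !inE ui eqxx.
    move=> no_max; apply/existsP; apply: contraR no_max.
    by rewrite negb_exists => /forallP no_max; apply/ffun_onP=> i; rewrite inE.
  rewrite cardsCs setCK cardsE card_ffun_on card_ffun !card_ord.
  by rewrite cardC1 card_ord.
- by move=> u _; rewrite size_map size_iota.
- move=> u; rewrite inE => /existsP[i /eqP ui]; rewrite inE; apply/andP; split.
    apply/forall_inP => A; rewrite inE => /mapP[l].
    rewrite mem_iota add0n => /andP[_ lt_lM] ->; rewrite inE /=.
    by apply/set0Pn; exists i; rewrite inE ui.
  apply/forall_inP => A; rewrite inE => /mapP[l _ ->].
  apply/forall_inP => B; rewrite inE => /mapP[l' _ ->].
  case: (leqP l l') => [le_ll'|/ltnW le_ll']; apply/orP; [right|left].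
    by apply/subsetP=> j; rewrite !inE; apply: leq_ltn_trans.
  by apply/subsetP=> j; rewrite !inE; apply: leq_ltn_trans.
- move=> u u' _ _ /seq.permP eq_uu'; apply/ffunP=> i; apply: val_inj.
  by rewrite /= -!dec_count eq_uu'.
move=> t0 size_t0; rewrite inE => /andP[/forall_inP t0_face /forall_inP t0_ch].
(* Listed by decreasing cardinal, the members of a chain decrease. *)
pose ge_card (A B : {set 'I_n.+1}) := (#|B| <= #|A|)%N.
pose t := sort ge_card t0.
have perm_t : perm_eq t t0 by rewrite perm_sort.
have mem_t A : (A \in t) = (A \in t0) by rewrite (perm_mem perm_t).
have size_t : size t = M by rewrite (perm_size perm_t).
have t_sorted : sorted ge_card t by apply: sort_sorted => A B; apply: leq_total.
have sub_t l l' : (l <= l' < M)%N -> nth set0 t l' \subset nth set0 t l.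
  case/andP=> le_ll' lt_l'M; have lt_lM := leq_ltn_trans le_ll' lt_l'M.
  have tt l1 : (l1 < M)%N -> nth set0 t l1 \in [set A in t0].
    by move=> lt_l1; rewrite inE -mem_t mem_nth // size_t.
  have /forall_inP/(_ _ (tt _ lt_l'M))/orP[sub_ll'|//] := t0_ch _ (tt _ lt_lM).
  have card_l' : (#|nth set0 t l'| <= #|nth set0 t l|)%N.
    apply: (sorted_leq_nth _ _ _ t_sorted); rewrite ?inE ?size_t //.
    - move=> A B C; rewrite /ge_card => leBA leAC.
      exact: leq_trans leAC leBA.
    - by move=> A; apply: leqnn.
  by move: card_l'; rewrite (geq_leqif (subset_leqif_cards sub_ll')) => /eqP->.
pose u : {ffun 'I_n.+1 -> 'I_M.+1} :=
  [ffun i => inord (count (fun A : {set 'I_n.+1} => i \in A) t)].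
have uE i : u i = count (fun A : {set 'I_n.+1} => i \in A) t :> nat.
  by rewrite ffunE inordK // ltnS -size_t count_size.
have nth_t l i : (l < M)%N -> (i \in nth set0 t l) = (l < u i)%N.
  by move=> lt_lM; rewrite uE mem_nth_decreasing ?size_t.
have decE : dec u = t.
  apply: (@eq_from_nth _ set0); rewrite ?size_map ?size_iota ?size_t //.
  move=> l lt_l.
  rewrite (nth_map 0) ?size_iota // nth_iota // add0n.
  by apply/setP=> i; rewrite inE nth_t.
exists u; last by rewrite decE.
rewrite inE; apply/existsP; case: (posnP M) => [M0|M_gt0].
  exists ord0; rewrite -val_eqE eqn_leq -ltnS ltn_ord /=.
  exact: leq_trans (eq_leq M0) (leq0n _).
have : nth set0 t M.-1 \in [set A in t0].
  by rewrite inE -mem_t mem_nth // size_t prednK.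
move/t0_face=> /andP[_ /set0Pn[i]]; rewrite nth_t ?prednK // => le_Mu.
exists i; rewrite -val_eqE /= eqn_leq le_Mu andbT.
by rewrite -ltnS.
Qed.

End SdSimplex.

(** * Edgewise subdivision multiplies degrees by [r] *)

Section EdgewiseMonomials.

(** Hermite's identity: the floors share [x] as evenly as possible. *)
Lemma sum_divnD m x : (0 < m)%N -> (\sum_(i < m) (x + i) %/ m = x)%N.
Proof.
case: m => // m _; elim: x => [|x IHx].
  by apply: big1 => i _; rewrite add0n divn_small.
rewrite big_ord_recr /= addSnnS divnDr // divnn /= addn1 addnS.
rewrite -[X in _ = X.+1]IHx big_ord_recl addn0 [in RHS]addnC /=.
by congr (_ + _).+1; apply: eq_bigr => i _; rewrite addSnnS.
Qed.

(** Conversely, the floors are the only nondecreasing way of sharing their sum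
    into [m] integers that differ by at most 1. *)
Lemma divn_of_pinched m (x : nat -> nat) i :
  (forall j k, j <= k < m -> x j <= x k <= (x j).+1)%N -> (i < m)%N ->
  x i = ((\sum_(j < m) x j + i) %/ m)%N.
Proof.
move=> pinch lt_im; have m_gt0 : (0 < m)%N by apply: leq_ltn_trans lt_im.
have sumE a : (a <= m)%N -> (\sum_(j < m) (j < a)%N = a)%N.
  move=> le_am; rewrite -[RHS](count_ltn_iota le_am) -sum1_count.
  rewrite [RHS]big_mkcond /= -[in iota 0 m](subn0 m) big_mkord.
  by apply: eq_bigr => j _; case: ifP.
have lower : (m * x i <= \sum_(j < m) x j + i)%N.
  rewrite -[i in X in (_ <= X)%N](sumE i (ltnW lt_im)) -big_split /=.
  rewrite -[m in (m * _)%N]card_ord -sum_nat_const leq_sum // => j _.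
  have [lt_ji|le_ij] := ltnP j i.
    by have := pinch j i; rewrite (ltnW lt_ji) lt_im addn1 => /(_ isT)/andP[].
  by have := pinch i j; rewrite le_ij ltn_ord addn0 => /(_ isT)/andP[].
have upper : (\sum_(j < m) x j + i.+1 <= m * (x i).+1)%N.
  rewrite -[i.+1 in X in (X <= _)%N](sumE i.+1 lt_im) -big_split /=.
  rewrite -[m in (m * _)%N]card_ord -sum_nat_const leq_sum // => j _.
  have [le_ji|lt_ij] := leqP j i; rewrite ltnS.
    have := pinch j i; rewrite le_ji lt_im addn1 => /(_ isT)/andP[le_x _].
    by rewrite ltnS.
  rewrite [(j <= i)%N]leqNgt lt_ij addn0.
  by have := pinch i j; rewrite (ltnW lt_ij) ltn_ord => /(_ isT)/andP[].
apply/eqP; rewrite eqn_leq leq_divRL // mulnC lower /=.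
by rewrite -ltnS ltn_divLR // mulnC -addnS.
Qed.

Variables (T : finType) (D : simplicial_complex T) (s : seq T).
Hypothesis sP : vertex_ordering D s.

Let s_uniq : uniq s.
Proof. by rewrite (perm_uniq sP) enum_uniq. Qed.

Let mem_s v : (v \in s) = (v \in vertices D).
Proof. by rewrite (perm_mem sP) mem_enum. Qed.

(** When [k] is one more than the position of [v], this is [iota_map s h v]. *)
Definition prefix_sum b (h : {ffun T -> 'I_b.+1}) k : nat :=
  (\sum_(u <- take k s) (h u : nat))%N.

Lemma prefix_sum0 b (h : {ffun T -> 'I_b.+1}) : prefix_sum h 0 = 0%N.
Proof. by rewrite /prefix_sum take0 big_nil. Qed.

Lemma prefix_sumS b (h : {ffun T -> 'I_b.+1}) v :
  (v \notin s -> h v = 0%N :> nat) ->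
  prefix_sum h (index v s).+1 = (prefix_sum h (index v s) + h v)%N.
Proof.
move=> h0; have [sv|s'v] := boolP (v \in s); last first.
  by rewrite h0 // addn0 /prefix_sum memNindex // !take_oversize.
rewrite /prefix_sum (take_nth v) ?index_mem // nth_index //.
by rewrite -cats1 big_cat big_seq1.
Qed.

Lemma prefix_sum_all b (h : {ffun T -> 'I_b.+1}) k : (size s <= k)%N ->
  prefix_sum h k = (\sum_(v in vertices D) (h v : nat))%N.
Proof.
by move=> le_sk; rewrite /prefix_sum take_oversize // (perm_big _ sP) big_enum.
Qed.

Lemma prefix_sum_leS b (h : {ffun T -> 'I_b.+1}) k :
  (prefix_sum h k <= prefix_sum h k.+1)%N.
Proof.
rewrite /prefix_sum -[in X in (_ <= X)%N](cat_take_drop k (take k.+1 s)).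
by rewrite big_cat /= take_takel ?leqW // leq_addr.
Qed.

Lemma prefix_sum_leq b (h : {ffun T -> 'I_b.+1}) k :
  (prefix_sum h k <= \sum_(v in vertices D) (h v : nat))%N.
Proof.
rewrite -(prefix_sum_all h (leqnn _)) {2}/prefix_sum take_size.
rewrite -[s in X in (_ <= X)%N](cat_take_drop k).
by rewrite big_cat leq_addr.
Qed.

(** Induction on positions of [s], with the vertex at the current position at
    hand. *)
Lemma prefix_sum_ind (P : nat -> Prop) :
  P 0%N -> (forall v, v \in s -> P (index v s) -> P (index v s).+1) ->
  forall k, (k <= size s)%N -> P k.
Proof.
move=> P0 PS; elim=> // k IHk lt_ks.
have [v0 _] : exists v0 : T, true by case: (s) lt_ks => // v0; exists v0.
rewrite -[k](index_uniq v0 lt_ks s_uniq); apply: PS; first exact: mem_nth.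
by rewrite index_uniq //; apply/IHk/ltnW.
Qed.

Lemma supp0 b (f : {ffun T -> 'I_b.+1}) v :
  fsupp f \in faces D -> v \notin s -> f v = 0%N :> nat.
Proof.
move=> Df; rewrite mem_s inE; apply: contraNeq => fv.
by apply: faces_sub Df; rewrite sub1set inE.
Qed.

Variables (r m : nat).

(** The value at [v] of the [i]-th of the [m] vertices whose product is [g]: the
    increment at [v] of the partial sums floor((G + i) / m), where G runs over
    the partial sums of [g]. *)
Definition share (g : {ffun T -> 'I_(r * m).+1}) (i : nat) (v : T) : nat :=
  ((prefix_sum g (index v s).+1 + i) %/ m -
   (prefix_sum g (index v s) + i) %/ m)%N.

Definition piece (g : {ffun T -> 'I_(r * m).+1}) (i : nat) :
  {ffun T -> 'I_r.+1} := [ffun v => inord (share g i v)].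

(** The increments telescope; [share_eq_prefix] is the converse. *)
Lemma prefix_share_eq (g : {ffun T -> 'I_(r * m).+1})
    (h : {ffun T -> 'I_r.+1}) i :
  (i < m)%N -> (forall v, v \in s -> h v = share g i v :> nat) ->
  forall k, (k <= size s)%N ->
  prefix_sum h k = ((prefix_sum g k + i) %/ m)%N.
Proof.
move=> lt_im hE; apply: prefix_sum_ind.
  by rewrite !prefix_sum0 divn_small.
move=> v sv IH; rewrite prefix_sumS; last by rewrite sv.
rewrite IH hE // /share subnKC // leq_div2r // leq_add2r.
exact: prefix_sum_leS.
Qed.

Lemma share_eq_prefix (g : {ffun T -> 'I_(r * m).+1}) (f : {ffun T -> 'I_r.+1})
    i v :
  (i < m)%N -> fsupp f \in faces D ->
  (forall k, (k <= size s)%N ->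
     prefix_sum f k = ((prefix_sum g k + i) %/ m)%N) ->
  share g i v = f v.
Proof.
move=> lt_im Df fE; have [sv|s'v] := boolP (v \in s).
  rewrite /share -!fE ?index_mem //; last by rewrite ltnW ?index_mem.
  by rewrite prefix_sumS ?sv // addKn.
rewrite (supp0 Df) // /share memNindex // /prefix_sum !take_oversize //.
by rewrite subnn.
Qed.

Section Pieces.

Variable g : {ffun T -> 'I_(r * m).+1}.
Hypothesis gV : g \in esd_vertices (r * m) D.

Let gD : fsupp g \in faces D.
Proof. by move: gV; rewrite inE => /andP[]. Qed.

Let sum_g : (\sum_(v in vertices D) (g v : nat) = r * m)%N.
Proof. by move: gV; rewrite inE => /andP[_ /eqP]. Qed.

Lemma pieceE i v : (i < m)%N -> piece g i v = share g i v :> nat.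
Proof.
move=> lt_im; rewrite ffunE inordK // ltnS; apply: leq_trans (leq_subr _ _) _.
have m_gt0 : (0 < m)%N by apply: leq_ltn_trans lt_im.
rewrite -ltnS ltn_divLR // mulSn addnC -addSn leq_add //.
exact: leq_trans (prefix_sum_leq _ _) (eq_leq sum_g).
Qed.

Lemma prefix_sum_piece i k : (i < m)%N -> (k <= size s)%N ->
  prefix_sum (piece g i) k = ((prefix_sum g k + i) %/ m)%N.
Proof.
by move=> lt_im; apply: prefix_share_eq => // v _; apply: pieceE.
Qed.

Lemma fsupp_piece i : (i < m)%N -> fsupp (piece g i) \subset fsupp g.
Proof.
move=> lt_im; apply/subsetP=> v; rewrite !inE pieceE //.
apply: contraNneq => gv; rewrite /share prefix_sumS gv // addn0.
by rewrite subnn.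
Qed.

Lemma sum_pieces v : (\sum_(i < m) piece g i v = g v)%N.
Proof.
have [m0|m_gt0] := posnP m.
  have rm0 : (r * m = 0)%N by rewrite m0 muln0.
  have := ltn_ord (g v); rewrite ltnS => /leq_trans/(_ (eq_leq rm0)).
  rewrite leqn0 => /eqP->; apply: big1 => i _.
  by have := leq_trans (ltn_ord i) (eq_leq m0).
rewrite (eq_bigr (fun i : 'I_m => share g i v)) => [|i _]; last exact: pieceE.
rewrite sumnB => [|i _]; last by rewrite leq_div2r // leq_add2r prefix_sum_leS.
rewrite !sum_divnD // prefix_sumS ?addKn //; exact: supp0.
Qed.

Lemma piece_esd_vertex i : (i < m)%N -> piece g i \in esd_vertices r D.
Proof.
move=> lt_im; rewrite inE (faces_sub (fsupp_piece lt_im) gD) /=.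
have m_gt0 : (0 < m)%N by apply: leq_ltn_trans lt_im.
rewrite -(prefix_sum_all _ (leqnn _)) prefix_sum_piece //.
by rewrite prefix_sum_all // sum_g divnMDl // divn_small // addn0.
Qed.

Lemma iota_piece i v : (i < m)%N -> v \in s ->
  iota_map s (piece g i) v = ((prefix_sum g (index v s).+1 + i) %/ m)%N.
Proof. by move=> lt_im sv; apply: prefix_sum_piece; rewrite ?index_mem. Qed.

Lemma iota_diff01_piece i j : (i <= j < m)%N ->
  iota_diff01 D s (piece g j) (piece g i).
Proof.
case/andP=> le_ij lt_jm; have lt_im := leq_ltn_trans le_ij lt_jm.
have m_gt0 : (0 < m)%N by apply: leq_ltn_trans lt_im.
apply/forall_inP => v; rewrite -mem_s => sv; rewrite !iota_piece //.
set G := prefix_sum _ _.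
have le1 : ((G + i) %/ m <= (G + j) %/ m)%N by rewrite leq_div2r ?leq_add2l.
have : ((G + j) %/ m <= (G + i + m) %/ m)%N by rewrite leq_div2r //; lia.
by rewrite (divnDr _ (dvdnn m)) divnn m_gt0; lia.
Qed.

Definition pieces := [seq piece g i | i <- iota 0 m].

Lemma pieces_face : [set f in pieces] \in faces (esd r D s).
Proof.
have piecesP f :
    f \in [set f in pieces] -> exists2 i, (i < m)%N & f = piece g i.
  by rewrite inE => /mapP[i]; rewrite mem_iota => lt_im ->; exists i.
rewrite inE; apply/and3P; split.
- by apply/subsetP=> f /piecesP[i lt_im ->]; apply: piece_esd_vertex.
- apply: faces_sub gD; apply/bigcupsP=> f /piecesP[i lt_im ->].
  exact: fsupp_piece.
apply/forall_inP => f /piecesP[i lt_im ->].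
apply/forall_inP => f' /piecesP[j lt_jm ->].
by case: (leqP i j) => [le_ij|/ltnW le_ji]; apply/orP; [right|left];
  apply: iota_diff01_piece; apply/andP.
Qed.

End Pieces.

Definition iota_weight (f : {ffun T -> 'I_r.+1}) : nat :=
  (\sum_(v in vertices D) iota_map s f v)%N.

(** Vertices of a common face are comparable through [iota_map], hence ordered
    by the sum of its values. *)
Lemma iota_pinch (f f' : {ffun T -> 'I_r.+1}) v :
  iota_diff01 D s f f' || iota_diff01 D s f' f ->
  (iota_weight f <= iota_weight f')%N -> v \in vertices D ->
  (iota_map s f v <= iota_map s f' v <= (iota_map s f v).+1)%N.
Proof.
have iota_le (a b : {ffun T -> 'I_r.+1}) u :
    iota_diff01 D s a b -> u \in vertices D ->
    (iota_map s b u <= iota_map s a u <= (iota_map s b u).+1)%N.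
  by move=> /forall_inP/(_ u) + Du => /(_ Du)/orP[/eqP->|/eqP->]; lia.
case/orP=> ff' le_w Dv; last exact: iota_le.
have le_v u : u \in vertices D -> (iota_map s f' u <= iota_map s f u)%N.
  by move=> Du; have /andP[] := iota_le _ _ u ff' Du.
(* The weights leave no room for a strict inequality at [v]. *)
suff -> : iota_map s f v = iota_map s f' v by rewrite leqnn leqnSn.
apply/eqP; rewrite eqn_leq le_v // andbT.
move: le_w; rewrite /iota_weight (bigD1 v) //= [X in (_ <= X)%N](bigD1 v) //=.
apply: contraTT; rewrite -!ltnNge => lt_v.
rewrite -addSn leq_add //; apply: leq_sum => u /andP[Du _]; exact: le_v.
Qed.

(** Once the vertices of a face are listed by increasing weight, their partial
    sums at each position are nondecreasing and differ by at most 1, so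
    [divn_of_pinched] identifies them with those of the pieces of the
    product. *)
Lemma pieces_surj (t0 : seq {ffun T -> 'I_r.+1}) :
  size t0 = m -> [set f in t0] \in faces (esd r D s) ->
  exists2 g, g \in esd_vertices (r * m) D & perm_eq (pieces g) t0.
Proof.
move=> size_t0; rewrite inE => /and3P[/subsetP t0V t0D /forall_inP t0_diff].
pose le_w (f f' : {ffun T -> 'I_r.+1}) := (iota_weight f <= iota_weight f')%N.
pose t := sort le_w t0.
have perm_t : perm_eq t t0 by rewrite perm_sort.
have size_t : size t = m by rewrite (perm_size perm_t).
have mem_t f : f \in t -> f \in [set f in t0].
  by rewrite inE (perm_mem perm_t).
have tD f : f \in t -> fsupp f \in faces D.
  by move/mem_t/t0V; rewrite inE => /andP[].
have t_sorted : sorted le_w t by apply: sort_sorted => f f'; apply: leq_total.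
have sum_r : (\sum_(f <- t) r = r * m)%N.
  by rewrite big_const_seq count_predT size_t iter_addn_0.
pose g : {ffun T -> 'I_(r * m).+1} :=
  [ffun v => inord (\sum_(f <- t) (f v : nat))].
have gE v : g v = (\sum_(f <- t) (f v : nat))%N :> nat.
  rewrite ffunE inordK // ltnS -sum_r; apply: leq_sum => f _.
  by rewrite -ltnS.
have prefix_gE k : prefix_sum g k = (\sum_(f <- t) prefix_sum f k)%N.
  by rewrite /prefix_sum exchange_big /=; apply: eq_bigr => v _.
have gV : g \in esd_vertices (r * m) D.
  rewrite inE; apply/andP; split.
    apply: faces_sub t0D; apply/subsetP=> v; rewrite inE gE => gv.
    apply/bigcupP; have [f tf fv] : exists2 f, f \in t & (f v : nat) != 0%N.
      apply/hasP; apply: contraR gv; rewrite -all_predC => /allP t0v.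
      rewrite big_seq big1 // => f /t0v /=; rewrite negbK => /eqP //.
    by exists f; rewrite ?mem_t // inE.
  rewrite -(prefix_sum_all _ (leqnn _)) prefix_gE.
  rewrite big_seq (eq_bigr (fun=> r)) => [|f /mem_t/t0V]; last first.
    by rewrite inE prefix_sum_all // => /andP[_ /eqP].
  by rewrite -big_seq sum_r.
pose f0 : {ffun T -> 'I_r.+1} := [ffun => ord0].
have t_nth i : (i < m)%N -> nth f0 t i \in t by rewrite -size_t; apply: mem_nth.
have prefix_nth i k : (i < m)%N -> (k <= size s)%N ->
    prefix_sum (nth f0 t i) k = ((prefix_sum g k + i) %/ m)%N.
  move=> lt_im; move: k; apply: prefix_sum_ind => [|v sv _].
    by rewrite !prefix_sum0 divn_small.
  rewrite prefix_gE (big_nth f0) size_t big_mkord.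
  apply: (divn_of_pinched (x := fun i => iota_map s (nth f0 t i) v)) => //.
  move=> j k /andP[le_jk lt_km]; have lt_jm := leq_ltn_trans le_jk lt_km.
  apply: iota_pinch; last by rewrite -mem_s.
    have /forall_inP := t0_diff _ (mem_t _ (t_nth j lt_jm)).
    by apply; apply/mem_t/t_nth.
  apply: (sorted_leq_nth _ _ _ t_sorted); rewrite ?inE ?size_t //.
    by move=> f f' f''; apply: leq_trans.
  by move=> f; apply: leqnn.
exists g => //; suff -> : pieces g = t by [].
apply: (@eq_from_nth _ f0); rewrite size_map size_iota ?size_t // => i lt_im.
rewrite (nth_map 0%N) ?size_iota // nth_iota // add0n.
apply/ffunP=> v; apply: val_inj; rewrite /= pieceE //.
apply: share_eq_prefix => //; first exact/tD/t_nth.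
by move=> k; apply: prefix_nth.
Qed.

Lemma card_esd_vertices_esd :
  #|esd_vertices m (esd r D s)| = #|esd_vertices (r * m) D|.
Proof.
apply: (card_esd_vertices_decode (dec := pieces)); last exact: pieces_surj.
- by move=> g _; rewrite size_map size_iota.
- exact: pieces_face.
move=> g g' gV g'V eq_gg'; apply/ffunP=> v; apply: val_inj => /=.
rewrite -!sum_pieces //.
have sumE h : (\sum_(f <- pieces h) (f v : nat) = \sum_(i < m) piece h i v)%N.
  by rewrite big_map -[in iota 0 m](subn0 m) big_mkord.
by rewrite -!sumE; apply: perm_big.
Qed.

End EdgewiseMonomials.

(** * Colored permutations with a prescribed last letter *)

Section LastLetter.

Variable r : nat.

Lemma color_ord N (w : colored_perm r N) (i : 'I_N) : color w i = w.2 i.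
Proof. by rewrite /color valK. Qed.

Lemma coordinate_ord N (w : colored_perm r N) (i : 'I_N) :
  coordinate w i = (w.1 i).+1.
Proof. by rewrite /coordinate valK. Qed.

(** The values of [w] that are at least [v] are raised by 1 to make room for the
    new last value [v]. *)
Definition append n (c : 'I_r) (v : 'I_n.+2) (w : colored_perm r n.+1) :
    colored_perm r n.+2 :=
  (lift_perm ord_max v w.1, [ffun i => oapp w.2 c (unlift ord_max i)]).

Lemma color_append n c v (w : colored_perm r n.+1) (i : 'I_n.+1) :
  color (append c v w) i = color w i.
Proof. by rewrite -{1}lift_max !color_ord ffunE liftK. Qed.

Lemma coordinate_append n c v (w : colored_perm r n.+1) (i : 'I_n.+1) :
  coordinate (append c v w) i = (bump v (w.1 i)).+1.
Proof. by rewrite -lift_max coordinate_ord lift_perm_lift. Qed.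

Lemma color_append_last n c v (w : colored_perm r n.+1) :
  color (append c v w) n.+1 = c.
Proof.
by rewrite -[n.+1]/(val (@ord_max n.+1)) color_ord ffunE unlift_none.
Qed.

Lemma coordinate_append_last n c v (w : colored_perm r n.+1) :
  coordinate (append c v w) n.+1 = v.+1.
Proof.
by rewrite -[n.+1]/(val (@ord_max n.+1)) coordinate_ord lift_perm_id.
Qed.

Lemma append_bij n (c : 'I_r) (v : 'I_n.+2) :
  {on [pred w : colored_perm r n.+2 |
        (color w n.+1 == c) && (coordinate w n.+1 == v.+1)],
  bijective (@append n c v)}.
Proof.
(* The values other than the last one, renumbered. *)
pose std (s : 'S_n.+2) k := odflt k (unlift (s ord_max) (s (lift ord_max k))).
have stdK (s : 'S_n.+2) k :
    lift (s ord_max) (std s k) = s (lift ord_max k).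
  rewrite /std; have := neq_lift ord_max k.
  by rewrite -(can_eq (permK s)) => /unlift_some[] ? ? ->.
have inj_std s : injective (std s).
  move=> k1 k2 /(congr1 (lift (s ord_max))); rewrite !stdK.
  by move/perm_inj/lift_inj.
exists (fun w : colored_perm r n.+2 => (perm (inj_std w.1),
                  [ffun i => w.2 (lift ord_max i)]) : colored_perm r n.+1).
  move=> [s e] _; congr (_, _).
    apply/permP=> k; rewrite permE /std /= lift_perm_lift lift_perm_id.
    by rewrite liftK.
  by apply/ffunP=> i; rewrite !ffunE liftK.
move=> [s e] /andP[]; rewrite -[n.+1]/(val (@ord_max n.+1)).
rewrite color_ord coordinate_ord eqSS => /eqP/val_inj /= ec /eqP/val_inj /= sv.
congr (_, _).
  apply/permP=> k /=; case: (unliftP ord_max k) => [k'|] ->.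
    by rewrite lift_perm_lift permE -sv stdK.
  by rewrite lift_perm_id.
apply/ffunP=> i; rewrite ffunE /=; case: (unliftP ord_max i) => [i'|] ->.
  by rewrite /= ffunE.
by [].
Qed.

(** The descents between two letters, leaving out the last position, whose
    status depends on the color of the last letter only. *)
Definition inner_descents n (w : colored_perm r n.+1) : nat :=
  (\sum_(i < n) is_descent w i)%N.

(** Whether appending the last letter [(c, v)] to [w] creates a descent.  The
    coordinates start from 1, so [v < coordinate w n] compares [v] with the
    last value of [w] before it is raised, and allows equality. *)
Definition drops_to n (c v : nat) (w : colored_perm r n.+1) : bool :=
  (c < color w n)%N || ((color w n == c) && (v < coordinate w n)%N).

Lemma inner_descents_append n (c : 'I_r) (v : 'I_n.+2)
    (w : colored_perm r n.+1) :
  inner_descents (append c v w) = (inner_descents w + drops_to c v w)%N.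
Proof.
rewrite /inner_descents big_ord_recr /=; congr (_ + nat_of_bool _)%N.
  apply: eq_bigr => i _; congr nat_of_bool; rewrite /is_descent.
  have -> : i = widen_ord (leqnSn n) i :> nat by [].
  have -> : (widen_ord (leqnSn n) i).+1 = lift ord0 i :> nat by [].
  rewrite !color_append !coordinate_append !coordinate_ord /bump.
  by congr (_ || (_ && _)); lia.
rewrite /is_descent /drops_to color_append_last coordinate_append_last.
rewrite (color_append c v w ord_max : color _ n = _).
rewrite (coordinate_append c v w ord_max : coordinate _ n = _).
rewrite (coordinate_ord w ord_max : coordinate _ n = _) /= /bump.
by congr (_ || (_ && _)); lia.
Qed.

Local Open Scope ring_scope.

Definition last_letter_gf n (c v : nat) : {poly int} :=
  \sum_(w : colored_perm r n.+1 |
         [&& color w 0 == 0%N, color w n == c & coordinate w n == v.+1])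
    'X^(inner_descents w).

Lemma last_letter_gf_rec n c v : (c < r)%N -> (v < n.+2)%N ->
  last_letter_gf n.+1 c v =
  \sum_(w : colored_perm r n.+1 | color w 0 == 0%N)
    'X^(inner_descents w + drops_to c v w).
Proof.
move=> lt_cr lt_vn; pose c' := Ordinal lt_cr; pose v' := Ordinal lt_vn.
rewrite /last_letter_gf (reindex (append c' v')).
  apply: eq_big => w; last by rewrite inner_descents_append.
  rewrite (color_append c' v' w ord0 : color _ 0 = _).
  rewrite color_append_last coordinate_append_last.
  by rewrite !eqxx !andbT.
apply: subon_bij (@append_bij n c' v') => w.
by rewrite !inE => /andP[_].
Qed.

(** Replacing the last letter [(c, v)] by [(c, v.+1)] removes a descent exactly
    when the letters before it end with [(c, v)]. *)
Lemma last_letter_gf_step n c v : (c < r)%N -> (v < n.+1)%N ->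
  last_letter_gf n.+1 c v.+1 =
  last_letter_gf n.+1 c v + (1 - 'X) * last_letter_gf n c v.
Proof.
move=> lt_cr lt_vn; apply/eqP; rewrite addrC -subr_eq; apply/eqP.
rewrite !last_letter_gf_rec //; last exact: ltnW.
rewrite /last_letter_gf big_mkcondr mulr_sumr -sumrB.
apply: eq_bigr => w _; rewrite !exprD -mulrBr /drops_to.
case: (ltngtP c (color w n)) => //=; rewrite ?subrr ?mulr0 // => _.
case: (ltngtP v.+1 (coordinate w n)) => //= h; rewrite ?subrr ?mulr0 //.
by rewrite mulrC.
Qed.

(** Both last letters lie between the last letters of color [c] and those of
    color [c.+1] of the shorter words. *)
Lemma last_letter_gf_color n c : (c.+1 < r)%N ->
  last_letter_gf n.+1 c.+1 0 = last_letter_gf n.+1 c n.+1.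
Proof.
move=> lt_cr; rewrite !last_letter_gf_rec // 1?ltnW //.
apply: eq_bigr => w _; congr ('X^(_ + nat_of_bool _)); rewrite /drops_to.
rewrite (coordinate_ord w ord_max : coordinate _ n = _).
by have := ltn_ord (w.1 ord_max); lia.
Qed.

(** Appending the smallest letter always creates a descent, appending the
    largest one never does. *)
Lemma last_letter_gf_wrap n : (0 < r)%N ->
  last_letter_gf n.+1 0 0 = 'X * last_letter_gf n.+1 r.-1 n.+1.
Proof.
move=> r_gt0; rewrite !last_letter_gf_rec ?prednK // mulr_sumr.
apply: eq_bigr => w _; rewrite -exprS -addn1 -addnA; congr ('X^(_ + _)).
rewrite /drops_to (coordinate_ord w ord_max : coordinate _ n = _).
rewrite (color_ord w ord_max : color _ n = _).
by have := ltn_ord (w.1 ord_max); have := ltn_ord (w.2 ord_max); lia.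
Qed.

(** For positive [y], the value at [y] minus the value at [y.-1] of the function
    y ^ (n - v) * (y + 1) ^ v, which counts the vectors of length [n] in
    {0, ..., y} with [n - v] prescribed entries below [y]; the value
    at [y = 0] is the one for which the next lemmas hold there as well. *)
Definition last_letter_count n v y : int :=
  if y is y'.+1 then
    y%:R ^+ (n - v) * y.+1%:R ^+ v - y'%:R ^+ (n - v) * y%:R ^+ v
  else (v == n)%:R.

Lemma last_letter_count_step n v y : (v <= n)%N ->
  last_letter_count n.+1 v.+1 y =
  last_letter_count n.+1 v y + last_letter_count n v y.
Proof.
move=> le_vn; case: y => [|y] /=.
  by rewrite eqSS (ltn_eqF (_ : v < n.+1)%N) ?ltnS // add0r.
by rewrite subSS subSn // !exprS -!natr1; ring.
Qed.

Lemma last_letter_count_max n y :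
  last_letter_count n.+1 n.+1 y = y.+1%:R ^+ n.+1 - y%:R ^+ n.+1.
Proof.
case: y => [|y] /=; first by rewrite eqxx expr1n expr0n subr0.
by rewrite subnn !expr0 !mul1r.
Qed.

Lemma last_letter_count_color n y :
  last_letter_count n.+1 0 y.+1 = last_letter_count n.+1 n.+1 y.
Proof. by rewrite last_letter_count_max /= subn0 !expr0 !mulr1. Qed.

Lemma last_letter_gf0 c : (0 < r)%N ->
  last_letter_gf 0 c 0 = (c == 0%N)%:R.
Proof.
move=> r_gt0; rewrite /last_letter_gf.
pose w0 : colored_perm r 1 := (1%g, [ffun=> Ordinal r_gt0]).
have [->|c_neq0] := eqVneq c 0%N; last first.
  rewrite big_pred0 // => w; apply/negbTE; apply: contra c_neq0.
  by case/and3P=> /eqP w_first /eqP w_last _; rewrite -w_last w_first.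
rewrite (big_pred1 w0) => [|[s e]].
  by rewrite /inner_descents big_ord0 expr0.
rewrite /= (color_ord _ ord0 : color _ 0 = _).
rewrite (coordinate_ord _ ord0 : coordinate _ 0 = _).
rewrite (ord1 (s ord0)) andbT andbb.
apply/eqP/eqP => [/= e0|[_ ->]]; last by rewrite ffunE.
congr (_, _); first by apply/permP=> i; rewrite !ord1.
by apply/ffunP=> i; apply: val_inj; rewrite !ord1 ffunE.
Qed.

(** A last letter of color [c] evaluates the count at r m + c, so that passing
    to the next color increases the argument by 1 and passing from the last
    color to the first one increases [m] by 1. *)
Lemma numerator_last_letter_gf n c v : (c < r)%N -> (v <= n)%N ->
  numerator n (last_letter_gf n c v)
    (fun m => last_letter_count n v (r * m + c)).
Proof.
elim: n c v => [|n IHn] c v lt_cr le_vn.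
  have r_gt0 : (0 < r)%N by apply: leq_ltn_trans lt_cr.
  case: v le_vn => // _ m /=; rewrite last_letter_gf0 //.
  have -> : last_letter_count 0 0 (r * m + c) = ((r * m + c)%N == 0%N)%:R.
    by case: (r * m + c)%N => //= y; rewrite subrr.
  rewrite addn_eq0 muln_eq0 (gtn_eqF r_gt0) andbC /=.
  by case: (c == 0%N); rewrite ?coef1 ?coef0.
(* The error is the same for all last letters, and it equals its own delay. *)
pose e c v m := (last_letter_gf n.+1 c v)`_m -
  iter n.+1 backdiff (fun m => last_letter_count n.+1 v (r * m + c)) m.
have e_step d u m : (d < r)%N -> (u <= n)%N -> e d u.+1 m = e d u m.
  move=> lt_dr le_un; rewrite /e last_letter_gf_step // coefD.
  rewrite (numeratorS (IHn d u lt_dr le_un)).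
  rewrite (eq_iter_backdiff _ (fun m => last_letter_count_step _ le_un)).
  by rewrite iter_backdiffD opprD addrACA subrr addr0.
have e_max d u m : (d < r)%N -> (u <= n.+1)%N -> e d u m = e d 0%N m.
  by move=> lt_dr; elim: u => // u IHu lt_un; rewrite e_step ?IHu // ltnW.
have e_color d m : (d < r)%N -> e d 0%N m = e 0%N 0%N m.
  elim: d => // d IHd lt_dr; have lt_dr' := ltnW lt_dr.
  rewrite -IHd // -(e_max d n.+1) //.
  rewrite /e last_letter_gf_color //; congr (_ - _).
  by apply: eq_iter_backdiff => i; rewrite addnS last_letter_count_color.
have e_wrap m : e 0%N 0%N m = delay (e r.-1 n.+1) m.
  have r_gt0 : (0 < r)%N by apply: leq_ltn_trans lt_cr.
  rewrite /e last_letter_gf_wrap // coefXM.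
  rewrite (@eq_iter_backdiff _ _ (delay (fun m =>
    last_letter_count n.+1 n.+1 (r * m + r.-1)))).
    by rewrite iter_backdiff_delay; case: m => //= ; rewrite subrr.
  case=> [|i]; first by rewrite muln0.
  rewrite [RHS]/= -last_letter_count_color -addnS prednK //.
  by rewrite addn0 mulnS addnC.
move=> m; apply/eqP; rewrite -subr_eq0 -/(e c v m) e_max // e_color //.
apply/eqP; elim: m => [|m IHm]; rewrite e_wrap //=.
by rewrite e_max // ?e_color // prednK // (leq_ltn_trans _ lt_cr).
Qed.

End LastLetter.

Section DescentCount.
Local Open Scope ring_scope.

Lemma descents_last0 r n (w : colored_perm r n.+1) :
  color w n = 0%N -> descents w = inner_descents w.
Proof.
move=> w_last; rewrite /descents -sum1dep_card big_mkcond big_ord_recr /=.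
rewrite [X in (_ + X)%N](_ : _ = 0%N) ?addn0.
  by apply: eq_bigr => i _; case: is_descent.
have coordinate_end : coordinate w n.+1 = n.+2.
  by rewrite /coordinate insubN // -leqNgt.
rewrite /is_descent w_last ltn0 coordinate_end.
rewrite (coordinate_ord w ord_max : coordinate _ n = _).
by rewrite [(_ < (w.1 _).+1)%N]ltnNge ltnS ltnW ?andbF ?ltn_ord.
Qed.

Lemma coef_last_letter_gf r n v j :
  (last_letter_gf r n 0 v)`_j =
  Posz #|[set w : colored_perm r n.+1 |
           [&& color w 0 == 0%N, descents w == j,
               color w n == 0%N & coordinate w n == v.+1]]|.
Proof.
rewrite /last_letter_gf coef_sum -sum1dep_card -natz natr_sum.
rewrite big_mkcond [RHS]big_mkcond; apply: eq_bigr => w _.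
rewrite coefXn [j == _]eq_sym; case: (color w 0 == 0%N) => //=.
have [w_last|] := eqVneq (color w n) 0%N; last by rewrite andbF.
rewrite (descents_last0 w_last).
by case: (coordinate w n == v.+1); case: (inner_descents w == j).
Qed.

End DescentCount.

(** * The polynomials [p_poly] read umbrally *)

Section Umbral.
Local Open Scope ring_scope.

Lemma coef_expDX (R : nzRingType) (a : R) n i :
  ((a%:P + 'X) ^+ n)`_i = a ^+ (n - i) *+ 'C(n, i).
Proof.
rewrite exprDn_comm; last exact: commr_polyX.
rewrite coef_sum (eq_bigr (fun j : 'I_n.+1 =>
  a ^+ (n - i) *+ 'C(n, i) *+ (i == j))) => [|j _]; last first.
  rewrite coefMn -polyC_exp coefCM coefXn.
  by case: eqVneq => [->|_]; rewrite ?mulr1 ?mulr0 ?mul0rn.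
have [le_in|lt_ni] := leqP i n; last first.
  rewrite bin_small // big1 // => j _; rewrite mulr0n mul0rn //.
rewrite (bigD1 (inord i)) //= inordK // eqxx big1 ?addr0 // => j /negbTE ij.
by rewrite eq_sym -[i](inordK (_ : i < n.+1)%N) // (val_eqE j) ij.
Qed.

Variable F : nat -> nat -> nat.

(** The linear map sending the [i]-th power of the outer variable w to the
    h-polynomial of the simplex with [i] vertices, for [i < N]; the bound only
    serves to make the sum finite. *)
Definition umbral N (P : {poly {poly int}}) : {poly int} :=
  \sum_(i < N) P`_i * h_poly F i.

Lemma umbral_sum N K (P : nat -> {poly {poly int}}) :
  umbral N (\sum_(i < K) P i) = \sum_(i < K) umbral N (P i).
Proof.
rewrite exchange_big; apply: eq_bigr => i _.
by rewrite coef_sum mulr_suml.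
Qed.

Lemma umbralZ N c P : umbral N (c *: P) = c * umbral N P.
Proof.
by rewrite mulr_sumr; apply: eq_bigr => i _; rewrite coefZ mulrA.
Qed.

Lemma umbralB N P Q : umbral N (P - Q) = umbral N P - umbral N Q.
Proof.
by rewrite -sumrB; apply: eq_bigr => i _; rewrite coefB mulrBl.
Qed.

Lemma umbralXn N n : (n < N)%N -> umbral N 'X^n = h_poly F n.
Proof.
move=> lt_nN; rewrite /umbral (bigD1 (Ordinal lt_nN)) //= coefXn eqxx mul1r.
rewrite big1 ?addr0 // => i neq_in; rewrite coefXn.
case: eqVneq => [eq_in|]; last by rewrite mul0r.
by case/eqP: neq_in; apply: val_inj.
Qed.

(** Expanding (w - 1) ^ s gives the alternating sum that defines [l_poly]. *)
Lemma l_poly_umbral N s : (s < N)%N ->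
  l_poly F s = umbral N (('X - 1) ^+ s).
Proof.
move=> lt_sN; rewrite /umbral /l_poly.
rewrite (big_ord_widen_cond N predT (fun k =>
  (-1) ^+ (s - k) *: ('C(s, k)%:R *: h_poly F k))) // big_mkcond /=.
apply: eq_bigr => k _; rewrite addrC -polyC1 -polyCN coef_expDX.
case: ifP => [_|/negbT]; last by rewrite -leqNgt => /bin_small->; rewrite mul0r.
rewrite scalerA -mul_polyC polyCM polyC_exp polyCN polyC1.
by rewrite polyC_natr mulr_natr.
Qed.

(** The inner sum defining [p_poly] is a coefficient of the polynomial
    (1 + u) ^ (n - k) (t + u) ^ k in u, so that p_poly is its image when the
    powers of u are sent to the local h-polynomials, i.e. for u = w - 1. *)
Lemma p_poly_umbral N n k : (k <= n)%N -> (n < N)%N ->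
  p_poly F n k = umbral N ('X^(n - k) * ('X - (1 - 'X)%:P) ^+ k).
Proof.
move=> le_kn lt_nN.
pose Q : {poly {poly int}} := (1%:P + 'X) ^+ (n - k) * (('X)%:P + 'X) ^+ k.
have size_Q : (size Q <= n.+1)%N.
  apply: leq_trans (size_polyMleq _ _) _.
  have sizeDX (c : {poly int}) d : size ((c%:P + 'X) ^+ d) = d.+1.
    by rewrite addrC -[c]opprK polyCN size_exp_XsubC.
  by rewrite !sizeDX addnS /= addSn subnK.
have -> : 'X^(n - k) * ('X - (1 - 'X)%:P) ^+ k = Q \Po ('X - 1).
  have comp_exp (p : {poly {poly int}}) d :
      p ^+ d \Po ('X - 1) = (p \Po ('X - 1)) ^+ d.
    exact: (rmorphXn (comp_poly ('X - 1))).
  rewrite /Q comp_polyM !comp_exp !comp_polyD !comp_polyX !comp_polyC.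
  congr (_ ^+ _ * _ ^+ _); first by rewrite polyC1 addrC subrK.
  by rewrite polyCB polyC1 opprB addrA addrAC addrC addrA.
have -> : Q \Po ('X - 1) = \sum_(s < n.+1) Q`_s *: ('X - 1) ^+ s.
  rewrite comp_polyE (big_ord_widen _ (fun s => Q`_s *: ('X - 1) ^+ s) size_Q).
  rewrite big_mkcond; apply: eq_bigr => s _; case: ltnP => // le_s.
  by rewrite nth_default // scale0r.
rewrite (umbral_sum N n.+1 (fun s => Q`_s *: ('X - 1) ^+ s)).
apply: eq_bigr => s _.
have lt_sN : (s < N)%N by apply: leq_ltn_trans lt_nN; rewrite -ltnS.
rewrite umbralZ -l_poly_umbral // mulrC; congr (_ * _).
rewrite coefM; apply: eq_bigr => i _; rewrite !coef_expDX expr1n.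
rewrite mulrnAl mul1r -mulrnA mulnC subnBA 1?addnC -1?ltnS //.
by rewrite scaler_nat addnC.
Qed.

Lemma p_polyS n k : (k <= n)%N ->
  p_poly F n.+1 k.+1 = p_poly F n.+1 k - (1 - 'X) * p_poly F n k.
Proof.
move=> le_kn; rewrite !(@p_poly_umbral n.+2) ?ltnS // 1?leqW //.
rewrite -umbralZ -umbralB subSS subSn //; congr umbral.
by rewrite -mul_polyC !exprS; ring.
Qed.

Lemma p_poly0 n : p_poly F n 0 = h_poly F n.
Proof. by rewrite (@p_poly_umbral n.+1) // subn0 expr0 mulr1 umbralXn. Qed.

End Umbral.


(** * Comparison *)

Section Comparison.
Local Open Scope ring_scope.

Variables (r : nat) (r_gt0 : (0 < r)%N).
Variable ord : forall m : nat, seq {set 'I_m}.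
Hypothesis ordP : forall m : nat, vertex_ordering (sd (simplex m)) (ord m).

Lemma h_poly_colored_sd n :
  h_poly (colored_sd_triangle r ord) n = last_letter_gf r n 0 n.
Proof.
(* For n = 0 the sequence (r m + 1)^n - (r m)^n misses the empty monomial. *)
case: n => [|n].
  rewrite last_letter_gf0 // /h_poly big_ord_recl big_ord0 addr0 /=.
  rewrite !expr0 mulr1 -mulr_natr.
  suff -> : colored_sd_triangle r ord 0 0 = 1%N by rewrite scale1r.
  rewrite /colored_sd_triangle /face_number.
  set D := esd _ _ _.
  rewrite -(cards1 (set0 : {set {ffun {set 'I_0} -> 'I_r.+1}})).
  apply: eq_card => A; rewrite inE in_set1 cards_eq0 andbC.
  by case: eqP => //= ->; apply: (faces0 D).
set D := esd r (sd (simplex n.+1)) (ord n.+1).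
pose V : finType := {ffun {set 'I_n.+1} -> 'I_r.+1}.
apply: (@eq_face_polynomial _ (maxn n.+1 #|V|) _ _
  (fun m => (r * m).+1%:R ^+ n.+1 - (r * m)%:R ^+ n.+1)).
- exact: leq_maxl.
- move=> m; rewrite -natr_sum -(card_esd_vertices D) ?leq_maxr //.
  rewrite card_esd_vertices_esd // card_esd_vertices_sd_simplex.
  by rewrite natrB ?natrX // leq_exp2r.
apply: eq_numerator (numerator_last_letter_gf r_gt0 (leqnn n.+1)) => m.
by rewrite addn0 last_letter_count_max.
Qed.

Lemma p_poly_colored_sd n k : (k <= n)%N ->
  p_poly (colored_sd_triangle r ord) n k = last_letter_gf r n 0 (n - k).
Proof.
elim: k n => [|k IHk] n le_kn; first by rewrite p_poly0 h_poly_colored_sd subn0.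
case: n le_kn => // n le_kn; rewrite p_polyS // !IHk //; last exact: leqW.
rewrite subSS subSn // last_letter_gf_step ?addrK //.
by rewrite ltnS leq_subr.
Qed.

End Comparison.

Theorem proposition4p7 (r : nat) (r_gt0 : (0 < r)%N)
    (ord : forall m : nat, seq {set 'I_m})
    (ordP : forall m : nat, vertex_ordering (sd (simplex m)) (ord m))
    (n k j : nat) (le_kn : (k <= n)%N) (le_jn : (j <= n)%N) :
  p_coef (colored_sd_triangle r ord) n k j =
  Posz #|[set w : colored_perm r n.+1 |
           [&& color w 0 == 0%N,
               descents w == j,
               color w n == 0%N &
               coordinate w n == (n.+1 - k)%N]]|.
Proof.
rewrite /p_coef (p_poly_colored_sd r_gt0 ordP le_kn) coef_last_letter_gf.
by rewrite subSn.
Qed.
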